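(* Fix positive integers $a$ and $b$. For every $\varepsilon>0$ there exists $n_0$ such that for all $n\ge n_0$, every subset $A\subseteq\{1,\dots,n\}$ with no nontrivial solution $(x_1,\dots,x_5)\in A^5$ to the equation $a x_1+a x_2+b x_3=a x_4+(a+b)x_5$ satisfies $|A|\le\varepsilon\sqrt n$. Here a solution is trivial if it is of the form $(x_1,\dots,x_5)=(x,y,y,x,y)$ or $(y,x,y,x,y)$, or (only when $a=b$) $(y,y,x,x,y)$, for some $x,y\in\mathbb Z$.
   Context: Equivalently, such a set has size $o(\sqrt n)$. *)

(* Defs.v *)
From Stdlib Require Import ZArith Reals List.
Open Scope Z_scope.

Definition is_solution (a b x1 x2 x3 x4 x5 : Z) : Prop :=
  a * x1 + a * x2 + b * x3 = a * x4 + (a + b) * x5.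

Definition trivial_solution (a b x1 x2 x3 x4 x5 : Z) : Prop :=
  exists x y : Z,
    (x1 = x /\ x2 = y /\ x3 = y /\ x4 = x /\ x5 = y)
    \/ (x1 = y /\ x2 = x /\ x3 = y /\ x4 = x /\ x5 = y)
    \/ (a = b /\ x1 = y /\ x2 = y /\ x3 = x /\ x4 = x /\ x5 = y).

(* A finite set of integers, given as a duplicate-free list, has no nontrivial solution. *)
Definition no_nontrivial_solution (a b : Z) (A : list Z) : Prop :=
  forall x1 x2 x3 x4 x5 : Z,
    In x1 A -> In x2 A -> In x3 A -> In x4 A -> In x5 A ->
    is_solution a b x1 x2 x3 x4 x5 -> trivial_solution a b x1 x2 x3 x4 x5.

(* Main.v *)
Require Import Defs.
From Stdlib Require Import ZArith Reals List.
From Stdlib Require Import Lia Lra.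
From mathcomp Require all_boot all_order all_algebra all_field ring lra.

(** Taking [x3 = x5] shows that [A] is a Sidon set. Embed it in [G = Z/N], with [N]
    proportional to [n] and coprime to [a], [b], [a + b], and suppose that
    [N <= kappa |A|^2]. The uniform density [g] on [A] then has
    [sum |g^|^4 <= 2 kappa], because of the Sidon property. Let [f] be the convolution
    of [g] with the uniform density on a Bohr set of the large spectrum of [g]. The
    count of solutions is a sum of products of five Fourier coefficients, so the fourth
    moment bound on four of them and a sup bound on the change in the fifth show that
    passing from [g] to [f] changes it little. As each nonzero difference occurs at most
    once in [A], [f] is bounded in [L^2], uniformly in the Bohr set.
    For such an [f] the count is bounded below: the solutions are
    [(y, x - b t - s, x + a t, y - s, x)], and summing over [y] and [s] leaves
    [sum_(x,t) f(x) f(x + a t) K(x - b t)] with [K = f * f~ * f], which is almost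
    periodic, so for [t] in the difference set of a Bohr set [K(x - b t)] can be
    replaced by [K(x)] and Cauchy-Schwarz applies. But [A] has only its at most
    [3 |A|^2] trivial solutions, so [|A|] is bounded in terms of [kappa]. *)

Module SparseFourier.
Import all_boot all_order all_algebra all_field ring lra.

Set Implicit Arguments.
Unset Strict Implicit.
Unset Printing Implicit Defensive.

Import Order.TTheory GRing.Theory Num.Theory.
Local Open Scope ring_scope.

(** * Fourier analysis on a finite commutative ring *)

Section Fourier.
Context (G : finComNzRingType) (e : G -> algC).

(** The pairing [e (x * y)] identifies [G] with its dual, the last clause being orthogonality.
    Frequencies are thus elements of [G], and the coefficients of the equation act on them by
    multiplication. *)
Definition nondegenerate_character : Prop :=
  [/\ {morph e : x y / x + y >-> x * y}, forall x, `|e x| = 1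
    & forall x, \sum_y e (x * y) = (x == 0)%:R * #|G|%:R].

Context (e_char : nondegenerate_character).

Local Lemma eD : {morph e : x y / x + y >-> x * y}. Proof. by case: e_char. Qed.
Local Lemma e_norm x : `|e x| = 1. Proof. by case: e_char. Qed.
Local Lemma e_sum x : \sum_y e (x * y) = (x == 0)%:R * #|G|%:R.
Proof. by case: e_char. Qed.

Local Lemma e_neq0 x : e x != 0.
Proof. by rewrite -normr_eq0 e_norm oner_eq0. Qed.

Local Lemma e0 : e 0 = 1.
Proof. by apply: (mulfI (e_neq0 0)); rewrite -eD addr0 mulr1. Qed.

Local Lemma eN x : e (- x) = (e x)^*.
Proof.
apply: (mulfI (e_neq0 x)); rewrite -eD subrr e0.
by rewrite -normCK e_norm expr1n.
Qed.

(** No normalisation is made. Densities are rational, where the order is total; [ratr] carries them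
    into [algC], where conjugation fixes their values. *)
Definition fourier (h : G -> rat) (xi : G) : algC :=
  \sum_x ratr (h x) * e (x * xi).

Definition conv (h k : G -> rat) (x : G) : rat := \sum_y h y * k (x - y).

Definition corr (h : G -> rat) (s : G) : rat := \sum_y h y * h (y - s).

Lemma sum_shift (V : nmodType) (F : G -> V) y : \sum_x F (x - y) = \sum_x F x.
Proof. by rewrite [RHS](reindex_inj (addIr (- y))). Qed.

Lemma fourier_conv h k xi : fourier (conv h k) xi = fourier h xi * fourier k xi.
Proof.
rewrite /fourier /conv mulr_suml.
under eq_bigr => x _ do rewrite rmorph_sum /= mulr_suml.
rewrite exchange_big /=; apply: eq_bigr => y _.
rewrite mulr_sumr -[RHS](sum_shift _ y); apply: eq_bigr => x _.
rewrite rmorphM /= [RHS]mulrACA; congr (_ * _).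
by rewrite -eD -mulrDl addrC subrK.
Qed.

Lemma fourierN h xi : fourier h (- xi) = (fourier h xi)^*.
Proof.
rewrite rmorph_sum; apply: eq_bigr => x _.
by rewrite mulrN eN rmorphM /= fmorph_rat.
Qed.

Lemma fourier_corr h xi : fourier (corr h) xi = `|fourier h xi| ^+ 2.
Proof.
rewrite normCK -fourierN /fourier /corr mulr_suml.
under eq_bigr => x _ do rewrite rmorph_sum /= mulr_suml.
rewrite exchange_big /=; apply: eq_bigr => y _.
rewrite mulr_sumr (reindex_inj (subrI y)) /=; apply: eq_bigr => x _.
rewrite subKr rmorphM /= [RHS]mulrACA; congr (_ * _).
by rewrite -eD mulrBl mulrN.
Qed.

Lemma fourier_inv h x :
  \sum_xi fourier h xi * e (- (x * xi)) = #|G|%:R * ratr (h x).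
Proof.
rewrite /fourier; under eq_bigr => xi _ do rewrite mulr_suml.
rewrite exchange_big (bigD1 x) //= [X in _ + X]big1 ?addr0 => [|y y_neq].
  under eq_bigr => xi _ do rewrite -mulrA -eD subrr e0.
  by rewrite sumr_const mulr1 mulr_natl.
under eq_bigr => xi _ do rewrite -mulrA -eD -mulrBl.
by rewrite -mulr_sumr e_sum subr_eq0 (negbTE y_neq) mul0r mulr0.
Qed.

Lemma plancherel h k :
  \sum_xi fourier h xi * (fourier k xi)^* = #|G|%:R * ratr (\sum_x h x * k x).
Proof.
under eq_bigr => xi _ do rewrite -fourierN {2}/fourier mulr_sumr.
rewrite exchange_big rmorph_sum mulr_sumr; apply: eq_bigr => x _.
under eq_bigr => xi _ do rewrite mulrCA mulrN.
by rewrite -mulr_sumr fourier_inv rmorphM /=; ring.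
Qed.

Lemma fourier0 h : fourier h 0 = ratr (\sum_x h x).
Proof.
by rewrite rmorph_sum; apply: eq_bigr => x _; rewrite mulr0 e0 mulr1.
Qed.

Lemma fourier_le1 h xi :
  (forall x, 0 <= h x) -> \sum_x h x = 1 -> `|fourier h xi| <= 1.
Proof.
move=> h0 h1; apply: le_trans (ler_norm_sum _ _ _) _.
rewrite -(rmorph1 (@ratr algC)) -h1 rmorph_sum ler_sum // => x _.
by rewrite normrM e_norm mulr1 ger0_norm ?ler0q.
Qed.

Definition triple_corr (h : G -> rat) : G -> rat := conv (corr h) h.

Lemma fourier_triple_corr h xi :
  fourier (triple_corr h) xi = `|fourier h xi| ^+ 2 * fourier h xi.
Proof. by rewrite fourier_conv fourier_corr. Qed.

(* The solutions of [a x1 + a x2 + b x3 = a x4 + (a + b) x5] are parametrized as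
   [(y, x - b t - s, x + a t, y - s, x)]; [triple_corr] is the sum over [y] and [s]. *)
Definition sol_weight (a b : G) (h : G -> rat) : rat :=
  \sum_x \sum_t h x * h (x + a * t) * triple_corr h (x - b * t).

(** With [u = x - b t] and [v = x + a t], the pairs [(x, t)] run over the triples with
    [a u + b v = (a + b) x]: injectivity of [a] makes [t] a function of [v] and determines [u]. A
    character sum detects this relation. *)
Lemma fourier_sol_weight (a b : G) h : injective ( *%R a) ->
  #|G|%:R * ratr (sol_weight a b h) =
  \sum_xi fourier (triple_corr h) (a * xi) * fourier h (b * xi)
          * fourier h (- ((a + b) * xi)).
Proof.
move=> a_inj; set K := triple_corr h.
have count u x v :
    \sum_xi e ((a * u + b * v - (a + b) * x) * xi)
    = (a * u == (a + b) * x - b * v)%:R * #|G|%:R.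
  by rewrite e_sum -addrA addr_eq0 opprB.
transitivity (\sum_x \sum_v \sum_u ratr (K u) * ratr (h v) * ratr (h x) *
   \sum_xi e ((a * u + b * v - (a + b) * x) * xi)).
  rewrite rmorph_sum mulr_sumr; apply: eq_bigr => x _.
  rewrite rmorph_sum mulr_sumr.
  rewrite [RHS](reindex_inj (addrI x)) [RHS](reindex_inj a_inj) /=.
  apply: eq_bigr => t _; under eq_bigr => u _ do rewrite count.
  rewrite (bigD1 (x - b * t)) //= big1 ?addr0 => [|u u_neq].
    rewrite (_ : _ == _) ?mul1r; last by apply/eqP; ring.
    by rewrite !rmorphM /= -/K; ring.
  rewrite (_ : _ == _ = false) ?mul0r ?mulr0 //.
  apply: contraNF u_neq => /eqP Hu; apply/eqP/a_inj; rewrite Hu; ring.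
under eq_bigr => x _ do under eq_bigr => v _ do
  under eq_bigr => u _ do rewrite mulr_sumr.
under eq_bigr => x _ do under eq_bigr => v _ do rewrite exchange_big /=.
under eq_bigr => x _ do rewrite exchange_big /=.
rewrite exchange_big /=; apply: eq_bigr => xi _.
rewrite /fourier mulr_sumr; apply: eq_bigr => x _.
rewrite -mulrA mulrCA mulr_suml; apply: eq_bigr => v _.
rewrite mulrCA mulr_suml; apply: eq_bigr => u _.
rewrite (_ : _ * xi = u * (a * xi) + v * (b * xi) + x * - ((a + b) * xi)); last by ring.
by rewrite !eD; ring.
Qed.

(** * Bohr sets *)

Lemma pigeonhole_fiber (I T : finType) (X : {set I}) (F : I -> T) :
  exists2 Y : {set I}, Y \subset X /\ {in Y &, forall x y, F x = F y}
    & (#|X| <= #|T| * #|Y|)%N.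
Proof.
have [->|[x0 _]] := set_0Vmem X.
  by exists set0; rewrite ?cards0 //; split=> [|x y]; rewrite ?sub0set ?inE.
pose fib t := [set x in X | F x == t].
have [t _ fib_max] := @arg_maxnP T (F x0) xpredT (fun t => #|fib t|) isT.
exists (fib t).
  split=> [|x y]; first by apply/subsetP=> x; rewrite inE => /andP[].
  by rewrite !inE => /andP[_ /eqP->] /andP[_ /eqP->].
rewrite -sum1_card (partition_big F xpredT) //= -sum_nat_const.
by apply: leq_sum => u _; rewrite sum1dep_card; apply: leq_trans (fib_max u isT).
Qed.

(** A grid of mesh [1 / k] on the square around the unit disc. Each axis has [2 k + 1] cells because
    the coordinate 1 gets the index [2 k], so [inord] never meets its default on the disc. *)
Definition disc_cell k (z : algC) : 'I_k.*2.+1 * 'I_k.*2.+1 :=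
  (inord (Num.truncn (('Re z + 1) * k%:R)), inord (Num.truncn (('Im z + 1) * k%:R))).

Lemma truncn_close k (x y : algC) : (0 < k)%N ->
  -1 <= x <= 1 -> -1 <= y <= 1 ->
  inord (Num.truncn ((x + 1) * k%:R)) =
  inord (Num.truncn ((y + 1) * k%:R)) :> 'I_k.*2.+1 ->
  `|x - y| <= k%:R^-1.
Proof.
move=> k0; have k0' : 0 < k%:R :> algC by rewrite ltr0n.
have itv (z : algC) : -1 <= z <= 1 -> let n := Num.truncn ((z + 1) * k%:R) in
    (n < k.*2.+1)%N && (n%:R <= (z + 1) * k%:R < n.+1%:R).
  move=> /andP[z1 z2] /=.
  have z0 : 0 <= (z + 1) * k%:R by rewrite mulr_ge0 ?ler0n // -lerBlDr sub0r.
  rewrite truncn_itv // andbT ltnS -(ler_nat algC).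
  apply: le_trans (_ : _ <= (z + 1) * k%:R) _; first by case/andP: (truncn_itv z0).
  by rewrite -muln2 natrM mulrC ler_wpM2l ?ler0n // (natrD _ 1 1) lerD2r.
move=> /itv/= /andP[x1 /andP[x2 x3]] /itv/= /andP[y1 /andP[y2 y3]].
move=> /(congr1 val); rewrite /= !inordK // => Exy; rewrite Exy in x2 x3.
rewrite -(ler_pM2r k0') mulVf ?gt_eqF // -[X in _ * X]ger0_norm ?ler0n // -normrM.
rewrite (_ : (x - y) * k%:R = (x + 1) * k%:R - (y + 1) * k%:R); last by ring.
have [u v] : (x + 1) * k%:R \is Num.real /\ (y + 1) * k%:R \is Num.real.
  by split; apply: ger0_real; apply: le_trans (ler0n _ _) _; eassumption.
rewrite real_ler_norml ?realB //; apply/andP; split.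
  by rewrite lerBrDl lerBlDr; apply: le_trans (ltW y3) _; rewrite -natr1 lerD2r.
by rewrite lerBlDr; apply: le_trans (ltW x3) _; rewrite -natr1 addrC lerD2l.
Qed.

Lemma disc_cell_close k z w : (0 < k)%N -> `|z| <= 1 -> `|w| <= 1 ->
  disc_cell k z = disc_cell k w -> `|z - w| <= 2%:R / k%:R.
Proof.
move=> k0 z1 w1 [ERe EIm].
have Re_itv u : `|u| <= 1 -> -1 <= 'Re u <= 1.
  move=> u1; rewrite -real_ler_norml ?Creal_Re //.
  exact: le_trans (leif_normC_Re_Creal u) u1.
have Im_itv u : `|u| <= 1 -> -1 <= 'Im u <= 1.
  move=> u1; rewrite -real_ler_norml ?Creal_Im // -ler_sqr ?nnegrE //.
  rewrite real_normK ?Creal_Im // expr1n.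
  apply: le_trans (_ : _ <= `|u| ^+ 2) _; last by rewrite expr_le1.
  by rewrite normC2_Re_Im lerDr -realEsqr Creal_Re.
rewrite [z]Crect [w]Crect.
rewrite (_ : _ - _ = 'Re z - 'Re w + 'i * ('Im z - 'Im w)); last by ring.
apply: le_trans (ler_normD _ _) _; rewrite normrM normCi mul1r mulr_natl mulr2n.
by rewrite lerD // truncn_close ?Re_itv ?Im_itv.
Qed.

Definition bohr_bound k n : nat := (k.*2.+1 * k.*2.+1) ^ n.

Lemma leq_bohr_bound k m n : (m <= n)%N -> (bohr_bound k m <= bohr_bound k n)%N.
Proof. by move=> le_mn; rewrite leq_pexp2l. Qed.

Lemma bohr_bound_gt0 k n : (0 < bohr_bound k n)%N.
Proof. by rewrite expn_gt0. Qed.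

(** Pigeonhole on the cell of [e (t * xi)], one frequency at a time. Two points of a common cell
    give close values, so it is the difference set of [B] that lies in the Bohr set. *)
Lemma bohr_large k (S : seq G) : (0 < k)%N ->
  exists2 B : {set G},
    forall t u xi, t \in B -> u \in B -> xi \in S ->
      `|e ((t - u) * xi) - 1| <= 2%:R / k%:R
    & (#|G| <= bohr_bound k (size S) * #|B|)%N.
Proof.
move=> k0; elim: S => [|zeta S [B HB le_B]].
  by exists setT => //; rewrite cardsT mul1n.
have [Y [/subsetP sYB Yconst] le_Y] :=
  pigeonhole_fiber B (fun t => disc_cell k (e (t * zeta))).
exists Y => [t u xi tY uY|].
  rewrite inE => /predU1P[->|]; last exact: HB (sYB _ tY) (sYB _ uY).
  have ->: `|e ((t - u) * zeta) - 1| = `|e (t * zeta) - e (u * zeta)|.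
    rewrite -[LHS]mulr1 -[X in _ * X](e_norm (u * zeta)) -normrM.
    by rewrite [X in `|X|]mulrBl mul1r -eD -mulrDl subrK.
  by apply: disc_cell_close; rewrite ?e_norm //; apply: Yconst.
apply: leq_trans le_B _; rewrite /bohr_bound /= expnSr -mulnA leq_mul2l.
by apply/orP; right; rewrite card_prod !card_ord in le_Y.
Qed.

(** * Elementary inequalities for sums over the group *)

Lemma card_large_le (F : G -> algC) (L D : nat) : (0 < D)%N ->
  (forall x, 0 <= F x) ->
  \sum_x F x <= L%:R -> (#|[set x | (D%:R^-1 <= F x)%R]| <= L * D)%N.
Proof.
move=> D0 F0 FL; rewrite -(ler_nat algC) natrM -ler_pdivrMr ?ltr0n //.
apply: le_trans FL; rewrite mulr_natl -sumr_const.
rewrite [leRHS](bigID [in [set x | D%:R^-1 <= F x]]) /=.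
rewrite -[leLHS]addr0 lerD ?sumr_ge0 // ler_sum // => x.
by rewrite inE.
Qed.

Lemma card_gt0 : 0 < #|G|%:R :> rat.
Proof. by rewrite ltr0n; apply/card_gt0P; exists 0. Qed.

(** Cauchy-Schwarz against a constant, from the nonnegativity of the variance. *)
Lemma sum_sqr_le (F : G -> rat) :
  (\sum_x F x) ^+ 2 <= #|G|%:R * \sum_x F x ^+ 2.
Proof.
set s : rat := \sum_x F x; have N0 := card_gt0.
have: 0 <= \sum_x (F x * #|G|%:R - s) ^+ 2 by apply: sumr_ge0 => x _; apply: sqr_ge0.
have sqE x : (F x * #|G|%:R - s) ^+ 2
    = F x ^+ 2 * #|G|%:R ^+ 2 - F x * (2%:R * s * #|G|%:R) + s ^+ 2 by ring.
under eq_bigr => x _ do rewrite sqE.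
have constE : \sum_(x : G) s ^+ 2 = #|G|%:R * s ^+ 2 by rewrite sumr_const mulr_natl.
rewrite big_split /= constE sumrB -!mulr_suml -/s.
set S : rat := \sum_x _; rewrite (_ : _ + _ = #|G|%:R * (#|G|%:R * S - s ^+ 2)); last by ring.
by rewrite pmulr_rge0 // subr_ge0.
Qed.

Lemma autocorr_le (h : G -> rat) (F : G -> G) : injective F ->
  \sum_x h x * h (F x) <= \sum_x h x ^+ 2.
Proof.
move=> F_inj; apply: le_trans (_ : _ <= \sum_x (h x ^+ 2 / 2%:R + h (F x) ^+ 2 / 2%:R)) _.
  by apply: ler_sum => x _; have := sqr_ge0 (h x - h (F x)); lra.
rewrite big_split /= -[X in X + _]mulr_suml -[X in _ + X]mulr_suml.
have <-: \sum_x h x ^+ 2 = \sum_x h (F x) ^+ 2 by rewrite (reindex_inj F_inj).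
lra.
Qed.

Lemma sum_conv h k : \sum_x conv h k x = (\sum_x h x) * \sum_x k x.
Proof.
rewrite exchange_big mulr_suml /=; apply: eq_bigr => y _.
by rewrite -mulr_sumr sum_shift.
Qed.

Lemma conv_ge0 h k : (forall x, 0 <= h x) -> (forall x, 0 <= k x) ->
  forall x, 0 <= conv h k x.
Proof. by move=> h0 k0 x; apply: sumr_ge0 => y _; apply: mulr_ge0. Qed.

Lemma corr_ge0 h : (forall x, 0 <= h x) -> forall x, 0 <= corr h x.
Proof. by move=> h0 x; apply: sumr_ge0 => y _; apply: mulr_ge0. Qed.

Lemma triple_corr_ge0 h : (forall x, 0 <= h x) -> forall x, 0 <= triple_corr h x.
Proof. by move=> h0; apply: conv_ge0 => //; apply: corr_ge0. Qed.

(** * Solutions weighted by a density bounded in L2 *)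

Section Dense.
Context (f : G -> rat) (L : nat).
Context (f_ge0 : forall x, 0 <= f x) (f_sum : \sum_x f x = 1).
Context (f_sqr : #|G|%:R * \sum_x f x ^+ 2 <= L%:R).

Let N : rat := #|G|%:R.
Let N0 : 0 < N := card_gt0.
Local Notation K := (triple_corr f).

Lemma dense_L_gt0 : (0 < L)%N.
Proof.
rewrite -(ltr_nat rat); apply: lt_le_trans f_sqr.
have := sum_sqr_le f; rewrite f_sum expr1n; exact: lt_le_trans.
Qed.

(** [corr f] is at most the sum of [f ^ 2], and [K] averages it against the probability density
    [f]. *)
Lemma triple_corr_le x : K x <= L%:R / N.
Proof.
have Q y : corr f y <= L%:R / N.
  rewrite ler_pdivlMr // mulrC; apply: le_trans f_sqr.
  rewrite ler_pM2l //; exact: autocorr_le (addIr _).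
apply: le_trans (_ : _ <= \sum_y L%:R / N * f (x - y)) _.
  by apply: ler_sum => y _; apply: ler_wpM2r.
by rewrite -mulr_sumr (reindex_inj (subrI x)) /=; under eq_bigr => y _ do rewrite subKr;
  rewrite f_sum mulr1.
Qed.

(** By Plancherel, [N] times the right side is the fourth moment of the Fourier transform of [f], to
    which frequency 0 alone contributes 1. *)
Lemma sum_triple_corr_ge : N^-1 <= \sum_x f x * K x.
Proof.
rewrite -(ler_pM2l N0) divff ?gt_eqF // -(ler_rat algC) rmorphM /= ratr_nat.
under eq_bigr => x _ do rewrite mulrC.
rewrite -plancherel (bigD1 0) //= fourier_triple_corr fourier0 f_sum !rmorph1.
rewrite normr1 expr1n !mulr1 lerDl; apply: sumr_ge0 => xi _.
by rewrite fourier_triple_corr -mulrA -normCK mulr_ge0 ?exprn_ge0.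
Qed.

Lemma sum_fourier_sqr h :
  \sum_xi `|fourier h xi| ^+ 2 = #|G|%:R * ratr (\sum_x h x ^+ 2).
Proof.
under [in RHS]eq_bigr => x _ do rewrite expr2.
by rewrite -plancherel; apply: eq_bigr => xi _; rewrite normCK.
Qed.

(** The coefficients of [K] are cubic in those of [f]. Two factors are summed by Plancherel; the
    third times [e (d * xi) - 1] is at most [2 / k], by the hypothesis on large coefficients and
    trivially on small ones. *)
Lemma triple_corr_almost_periodic (k : nat) d : (0 < k)%N ->
  (forall xi, k%:R^-1 <= `|fourier f xi| -> `|e (d * xi) - 1| <= 2%:R / k%:R) ->
  forall x, `|K (x - d) - K x| <= 2%:R * L%:R / (k%:R * N).
Proof.
move=> k0 Hd x; have k0' : 0 < k%:R :> rat by rewrite ltr0n.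
rewrite ler_pdivlMr ?mulr_gt0 // [k%:R * N]mulrC mulrA -ler_pdivlMr //.
rewrite -[N in _ * N]gtr0_norm // -normrM -(ler_rat algC) ratr_norm.
rewrite rmorphM rmorphB /= ratr_nat mulrC mulrBr -!fourier_inv -sumrB.
apply: le_trans (ler_norm_sum _ _ _) _.
apply: le_trans (_ : _ <= \sum_xi `|fourier f xi| ^+ 2 * (2%:R / k%:R)) _; last first.
  have : #|G|%:R * (\sum_y f y ^+ 2) * (2%:R / k%:R) <= 2%:R * L%:R / k%:R.
    by rewrite -[leRHS]mulrA [leRHS]mulrCA ler_pM2r ?divr_gt0.
  rewrite -mulr_suml sum_fourier_sqr -(ler_rat algC).
  by rewrite !rmorphM /= !fmorphV /= !ratr_nat.
apply: ler_sum => xi _; rewrite fourier_triple_corr.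
rewrite -mulrBr -mulrA normrM normrX normr_id; apply: ler_wpM2l; first exact: exprn_ge0.
have ->: - ((x - d) * xi) = - (x * xi) + d * xi by ring.
rewrite eD -{2}[e (- _)]mulr1 -mulrBr !normrM e_norm mul1r.
have [big|small] := boolP (k%:R^-1 <= `|fourier f xi|).
  apply: le_trans (_ : _ <= 1 * (2%:R / k%:R)) _; last by rewrite mul1r.
  by rewrite ler_pM // ?fourier_le1 // Hd.
rewrite mulrC ler_pM //; first by rewrite (le_trans (ler_normB _ _)) // e_norm normr1.
by rewrite -real_ltNge ?ger0_real ?invr_ge0 // in small; apply: ltW.
Qed.

(** This value makes the almost-periodicity error in [sol_weight_dense] half of the main term. In
    [dense_bound], the exponent [L * dense_radius ^ 2] bounds the size of the large spectrum. *)
Definition dense_radius : nat := 4 * L ^ 3.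
Definition dense_bound : nat := bohr_bound dense_radius (L * dense_radius ^ 2).

(** For fixed [u] the differences [t - u] are distinct, and the terms of [sol_weight] left out are
    nonnegative. *)
Lemma sol_weight_ge_differences (a b : G) (B : {set G}) :
  \sum_(t in B) \sum_(u in B)
     \sum_x f x * f (x + a * (t - u)) * K (x - b * (t - u))
  <= #|B|%:R * sol_weight a b f.
Proof.
pose P t := \sum_x f x * f (x + a * t) * K (x - b * t).
have P0 t : 0 <= P t.
  by apply: sumr_ge0 => x _; rewrite !mulr_ge0 ?triple_corr_ge0.
rewrite exchange_big /= mulr_natl -sumr_const; apply: ler_sum => u _.
have ->: sol_weight a b f = \sum_t P (t - u).
  by rewrite /sol_weight exchange_big sum_shift.
by rewrite [leRHS](bigID [in B]) lerDl sumr_ge0.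
Qed.

(** Cauchy-Schwarz for the function sending [x] to the sum of [J (x - a * t)] over [t] in [B];
    expanding its square produces the differences. *)
Lemma differences_square (a : G) (B : {set G}) (J : G -> rat) :
  (#|B|%:R * \sum_x J x) ^+ 2 <=
  N * \sum_(t in B) \sum_(u in B) \sum_x J x * J (x + a * (t - u)).
Proof.
have shiftB : #|B|%:R * \sum_x J x = \sum_x \sum_(t in B) J (x - a * t).
  rewrite exchange_big /= mulr_natl -sumr_const; apply: eq_bigr => t _.
  by rewrite sum_shift.
rewrite shiftB; apply: le_trans (sum_sqr_le _) _; rewrite ler_pM2l //.
under eq_bigr => x _ do rewrite expr2 big_distrlr.
rewrite exchange_big /=; apply: ler_sum => t _.
rewrite exchange_big /=; apply: ler_sum => u _.
rewrite -(sum_shift (fun x => J x * J (x + a * (t - u))) (a * t)).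
by rewrite le_eqVlt; apply/orP; left; apply/eqP; apply: eq_bigr => x _;
  congr (_ * J _); ring.
Qed.

Lemma sol_weight_dense (a b : G) : injective ( *%R a) ->
  1 <= 2%:R * L%:R * dense_bound%:R * (N * sol_weight a b f).
Proof.
move=> a_inj; have L0 := dense_L_gt0; have L0' : 0 < L%:R :> rat by rewrite ltr0n.
have h0 : (0 < dense_radius)%N by rewrite muln_gt0 expn_gt0 L0.
pose Lam := [set xi | (dense_radius ^ 2)%:R^-1 <= `|fourier f xi| ^+ 2].
have cardLam : (#|Lam| <= L * dense_radius ^ 2)%N.
  apply: card_large_le => [|xi|]; rewrite ?expn_gt0 ?h0 ?exprn_ge0 //.
  rewrite sum_fourier_sqr -[X in X * _](ratr_nat algC) -rmorphM /=.
  by rewrite -(ratr_nat _ L) ler_rat.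
(* The frequencies are dilated by [b] because [K] is to be shifted by [b * (t - u)]. *)
have [B HB le_B] := bohr_large [seq b * xi | xi <- enum Lam] h0.
have {}le_B : (#|G| <= dense_bound * #|B|)%N.
  apply: leq_trans le_B _; rewrite leq_mul2r size_map -cardE.
  by rewrite leq_bohr_bound ?orbT.
have M0 : 0 < dense_bound%:R :> rat by rewrite ltr0n bohr_bound_gt0.
have {}le_B : N <= dense_bound%:R * #|B|%:R by rewrite -natrM ler_nat.
have B0 : 0 < #|B|%:R :> rat by have := lt_le_trans N0 le_B; rewrite pmulr_rgt0.
set D := 2%:R * L%:R / (dense_radius%:R * N).
have HK t u x : t \in B -> u \in B -> K x - D <= K (x - b * (t - u)).
  move=> tB uB; rewrite lerBlDr -lerBlDl.
  apply: le_trans (ler_norm _) _; rewrite distrC.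
  apply: triple_corr_almost_periodic => // xi big.
  rewrite (_ : _ * xi = (t - u) * (b * xi)); last by ring.
  apply: HB => //; apply: map_f; rewrite mem_enum inE.
  by rewrite natrX -exprVn lerXn2r ?nnegrE ?invr_ge0.
(* Since [N / L * K y <= 1], a second weight [K y] can be inserted at [y = x + a * (t - u)]. The sum
   then pairs [J] with itself, as [differences_square] requires. *)
pose J x := f x * K x.
pose Q := \sum_(t in B) \sum_(u in B) \sum_x J x * J (x + a * (t - u)).
have HQ : #|B|%:R ^+ 2 / N ^+ 3 <= Q.
  have := differences_square a B J; rewrite -/Q => /(le_trans _) HQ.
  rewrite [N ^+ 3]exprS invfM mulrCA ler_pdivrMl // HQ // -[_ ^- 2]exprVn -exprMn.
  have SJ : N^-1 <= \sum_x J x by exact: sum_triple_corr_ge.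
  have SJ0 : 0 <= \sum_x J x by apply: le_trans SJ; rewrite invr_ge0 ltW.
  by rewrite lerXn2r ?nnegrE ?ler_pM2l // mulr_ge0 ?invr_ge0 // ltW.
have lower : N / L%:R * Q - #|B|%:R ^+ 2 * (D * (L%:R / N))
    <= #|B|%:R * sol_weight a b f.
  apply: le_trans (sol_weight_ge_differences a b B).
  have constB (c : rat) : #|B|%:R ^+ 2 * c = \sum_(t in B) \sum_(u in B) c.
    by rewrite !sumr_const -mulrnA -[RHS]mulr_natl natrM expr2.
  rewrite constB mulr_sumr -sumrB; apply: ler_sum => t tB.
  rewrite mulr_sumr -sumrB; apply: ler_sum => u uB.
  have corr_fle : \sum_x f x * f (x + a * (t - u)) <= L%:R / N.
    rewrite ler_pdivlMr // mulrC; apply: le_trans f_sqr.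
    rewrite ler_pM2l //; exact: autocorr_le (addIr _).
  have D0 : 0 <= D by rewrite divr_ge0 ?mulr_ge0 // ltW.
  apply: le_trans (_ : _ <= N / L%:R * \sum_x J x * J (x + a * (t - u)) -
      D * \sum_x f x * f (x + a * (t - u))) _.
    by rewrite lerD2l lerN2 ler_wpM2l.
  rewrite !mulr_sumr -sumrB; apply: ler_sum => x _.
  set y := x + _; have := HK t u x tB uB; set K' := K (x - _) => leK.
  have Ky : N / L%:R * K y <= 1.
    rewrite mulrAC ler_pdivrMr // mul1r mulrC -ler_pdivlMr //; exact: triple_corr_le.
  have fx := f_ge0 x; have fy := f_ge0 y; have Kx := triple_corr_ge0 f_ge0 x.
  apply: le_trans (_ : _ <= f x * f y * (K x - D)) _; last first.
    by rewrite ler_wpM2l // mulr_ge0.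
  rewrite /J mulrBr [D * _]mulrC lerD2r.
  rewrite (_ : _ * _ = f x * f y * K x * (N / L%:R * K y)); last by ring.
  by rewrite ler_piMr // !mulr_ge0.
have DE : D = (2%:R * L%:R ^+ 2 * N)^-1.
  rewrite /D /dense_radius natrM natrX; field.
  by rewrite !(gt_eqF N0, gt_eqF L0').
(* The main term is at least [#|B|^2 / (L N^2)] and the error is half of that bound. *)
have T_ge : #|B|%:R / (2%:R * L%:R * N ^+ 2) <= sol_weight a b f.
  rewrite -(ler_pM2l B0); apply: le_trans lower.
  rewrite [leLHS](_ : _ = N / L%:R * (#|B|%:R ^+ 2 / N ^+ 3) -
      #|B|%:R ^+ 2 * (D * (L%:R / N))).
    by rewrite lerD2r ler_wpM2l // divr_ge0 // ltW.
  by rewrite DE; field; rewrite !(gt_eqF N0, gt_eqF L0').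
apply: le_trans (_ : _ <= dense_bound%:R * #|B|%:R / N) _.
  by rewrite ler_pdivlMr // mul1r.
rewrite [leLHS](_ : _ = 2%:R * L%:R * dense_bound%:R *
    (N * (#|B|%:R / (2%:R * L%:R * N ^+ 2)))).
  by rewrite !ler_pM2l // !mulr_gt0.
by field; rewrite !(gt_eqF N0, gt_eqF L0').
Qed.

End Dense.

(** * Transference *)

Lemma norm_1subM_le (x y : algC) : `|x| <= 1 ->
  `|1 - x * y| <= `|1 - x| + `|1 - y|.
Proof.
move=> x1; rewrite (_ : 1 - x * y = (1 - x) + x * (1 - y)); last by ring.
apply: le_trans (ler_normD _ _) _; rewrite lerD2l normrM.
by rewrite ler_piMl.
Qed.

(** Any product of four of these norms is at most [M ^ 4], hence at most the sum of fourth powers,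
    whatever the multiplicities. *)
Lemma max_norm3 (u v w : algC) : exists M : algC,
  [/\ `|u| <= M, `|v| <= M, `|w| <= M & M ^+ 4 <= `|u| ^+ 4 + `|v| ^+ 4 + `|w| ^+ 4].
Proof.
have ge0 (x : algC) : 0 <= `|x| ^+ 4 by rewrite exprn_ge0.
have cmp (x y : algC) : (`|x| <= `|y|) || (`|y| <= `|x|) by rewrite real_leVge ?normr_real.
have fst4 (x y z : algC) : `|x| ^+ 4 <= `|x| ^+ 4 + `|y| ^+ 4 + `|z| ^+ 4.
  by rewrite -addrA lerDl; apply: addr_ge0.
have snd4 (x y z : algC) : `|y| ^+ 4 <= `|x| ^+ 4 + `|y| ^+ 4 + `|z| ^+ 4.
  by rewrite addrAC lerDr; apply: addr_ge0.
have trd4 (x y z : algC) : `|z| ^+ 4 <= `|x| ^+ 4 + `|y| ^+ 4 + `|z| ^+ 4.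
  by rewrite lerDr; apply: addr_ge0.
have /orP[uv|vu] := cmp u v.
  have /orP[vw|wv] := cmp v w; last by exists `|v|.
  by exists `|w|; split=> //; apply: le_trans uv vw.
have /orP[uw|wu] := cmp u w; last by exists `|u|.
by exists `|w|; split=> //; apply: le_trans vu uw.
Qed.

(** Here [u], [v], [w] stand for coefficients of [g] at the three dilated frequencies, up to
    conjugation, and [p], [q], [r] for those of the smoothing density. *)
Lemma quintic_stability (u v w p q r eta : algC) :
  `|p| <= 1 -> `|q| <= 1 -> `|r| <= 1 ->
  `|u| * `|1 - p| <= eta -> `|v| * `|1 - q| <= eta -> `|w| * `|1 - r| <= eta ->
  `| `|u| ^+ 2 * u * v * w - `|u * p| ^+ 2 * (u * p) * (v * q) * (w * r)|
  <= 5%:R * eta * (`|u| ^+ 4 + `|v| ^+ 4 + `|w| ^+ 4).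
Proof.
move=> p1 q1 r1 Hp Hq Hr; have [M [uM vM wM M4]] := max_norm3 u v w.
have M0 : 0 <= M := le_trans (normr_ge0 u) uM.
have eta0 : 0 <= eta by apply: le_trans Hp; rewrite mulr_ge0.
apply: le_trans (_ : _ <= 5%:R * eta * M ^+ 4) _; last first.
  by rewrite ler_wpM2l // mulr_ge0.
(* [1 - |p|^2 p q r] is a telescoping sum of five terms, each controlled by one factor. *)
rewrite (_ : _ - _ = u * u^* * u * v * w * (1 - p * (p^* * (p * (q * r))))); last first.
  by rewrite !normCK rmorphM /=; ring.
rewrite normrM.
have drop : `|1 - p * (p^* * (p * (q * r)))|
    <= `|1 - p| + (`|1 - p| + (`|1 - p| + (`|1 - q| + `|1 - r|))).
  have pc1 : `|p^*| <= 1 by rewrite norm_conjC.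
  have pcE : `|1 - p^*| = `|1 - p| by rewrite -norm_conjC rmorphB rmorph1 /= conjCK.
  apply: le_trans (norm_1subM_le _ p1) _; rewrite lerD2l.
  apply: le_trans (norm_1subM_le _ pc1) _; rewrite pcE lerD2l.
  apply: le_trans (norm_1subM_le _ p1) _; rewrite lerD2l.
  exact: norm_1subM_le.
apply: le_trans (ler_wpM2l (normr_ge0 _) drop) _.
rewrite !normrM norm_conjC.
rewrite (_ : _ * _ = `|u| * `|1 - p| * (`|u| * `|u| * `|v| * `|w|) *+ 3
   + `|v| * `|1 - q| * (`|u| * `|u| * `|u| * `|w|)
   + `|w| * `|1 - r| * (`|u| * `|u| * `|u| * `|v|)); last by ring.
rewrite (_ : 5%:R * eta * M ^+ 4 = eta * (M * M * M * M) *+ 3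
   + eta * (M * M * M * M) + eta * (M * M * M * M)); last by ring.
have four (x y z t : algC) : `|x| <= M -> `|y| <= M -> `|z| <= M -> `|t| <= M ->
    `|x| * `|y| * `|z| * `|t| <= M * M * M * M.
  by move=> *; do 3![apply: ler_pM; rewrite ?mulr_ge0 //].
by rewrite !lerD ?lerMn2r ?ler_pM ?mulr_ge0 ?four ?orbT.
Qed.

Lemma sum_dilate (c : G) (F : G -> algC) : injective ( *%R c) ->
  \sum_xi F (c * xi) = \sum_xi F xi.
Proof. by move=> c_inj; rewrite [RHS](reindex_inj c_inj). Qed.

(** [quintic_stability] is applied at each frequency with [eta = 2 / d]. The dilations by [a], [b]
    and [a + b] permute the frequencies, so each of the three fourth moments is at most [L], and
    [30 = 5 * 2 * 3]. *)
Lemma sol_weight_transfer (a b : G) (g mu : G -> rat) (L d : nat) :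
  injective ( *%R a) -> injective ( *%R b) -> injective ( *%R (a + b)) ->
  (forall x, 0 <= g x) -> \sum_x g x = 1 ->
  (forall x, 0 <= mu x) -> \sum_x mu x = 1 ->
  \sum_xi `|fourier g xi| ^+ 4 <= L%:R -> (0 < d)%N ->
  (forall xi, d%:R^-1 <= `|fourier g xi| -> `|1 - fourier mu xi| <= 2%:R / d%:R) ->
  `|#|G|%:R * sol_weight a b g - #|G|%:R * sol_weight a b (conv g mu)|
   <= 30%:R * L%:R / d%:R.
Proof.
move=> a_inj b_inj ab_inj g0 g1 mu0 mu1 gL d0 Hmu.
have eta xi : `|fourier g xi| * `|1 - fourier mu xi| <= 2%:R / d%:R.
  have [big|small] := boolP (d%:R^-1 <= `|fourier g xi|).
    by rewrite -[leRHS]mul1r ler_pM ?Hmu ?fourier_le1.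
  rewrite mulrC ler_pM //.
    apply: le_trans (ler_normB _ _) _; rewrite normr1.
    by rewrite (_ : 2%:R = 1 + 1) // lerD2l fourier_le1.
  by rewrite -real_ltNge ?ger0_real ?invr_ge0 // in small; apply: ltW.
rewrite -(ler_rat algC) ratr_norm rmorphB /= !rmorphM /= fmorphV !ratr_nat.
rewrite !fourier_sol_weight // -sumrB.
apply: le_trans (ler_norm_sum _ _ _) _.
apply: le_trans (_ : _ <= \sum_xi 5%:R * (2%:R / d%:R) *
   (`|fourier g (a * xi)| ^+ 4 + `|fourier g (b * xi)| ^+ 4
    + `|fourier g ((a + b) * xi)| ^+ 4)) _.
  apply: ler_sum => xi _; rewrite !fourier_triple_corr !fourier_conv !fourierN.
  rewrite -(norm_conjC (fourier g ((a + b) * xi))).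
  have conj_mu : 1 - (fourier mu ((a + b) * xi))^* = (1 - fourier mu ((a + b) * xi))^*.
    by rewrite rmorphB rmorph1.
  apply: quintic_stability; rewrite ?conj_mu ?norm_conjC ?fourier_le1 //; exact: eta.
rewrite -mulr_sumr !big_split /= !(sum_dilate (fun xi => `|fourier g xi| ^+ 4)) //.
rewrite [leRHS](_ : _ = 5%:R * (2%:R / d%:R) * (L%:R + L%:R + L%:R)); last first.
  by rewrite ratr_nat; ring.
by rewrite ler_wpM2l ?lerD // mulr_ge0 // divr_ge0.
Qed.

(** * Solution-free sets *)

Lemma sum_pick (V : pzRingType) (F : G -> V) c : \sum_x F x * (x == c)%:R = F c.
Proof.
rewrite (bigD1 c) //= eqxx mulr1 big1 ?addr0 // => x /negbTE->.
by rewrite mulr0.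
Qed.

Definition uniform (A : {set G}) (x : G) : rat := (x \in A)%:R / #|A|%:R.

Lemma uniform_ge0 A x : 0 <= uniform A x.
Proof. by rewrite divr_ge0. Qed.

Lemma sum_ind (A : {set G}) : \sum_x (x \in A)%:R = #|A|%:R :> rat.
Proof. by rewrite -natr_sum -sum1_card [in RHS]big_mkcond. Qed.

Lemma sum_uniform (A : {set G}) : (0 < #|A|)%N -> \sum_x uniform A x = 1.
Proof. by move=> A0; rewrite -mulr_suml sum_ind divff // pnatr_eq0 -lt0n. Qed.

Lemma corr_uniform0 (A : {set G}) : (0 < #|A|)%N ->
  corr (uniform A) 0 = #|A|%:R^-1.
Proof.
move=> A0; rewrite -[RHS]mulr1 -[X in _ = _ * X](sum_uniform A0) mulr_sumr.
apply: eq_bigr => x _.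
by rewrite subr0 /uniform; case: (x \in A); rewrite ?mul0r ?mulr0 ?mul1r.
Qed.

Lemma sum_corr h : \sum_x corr h x = (\sum_x h x) ^+ 2.
Proof.
rewrite exchange_big expr2 mulr_suml; apply: eq_bigr => y _.
rewrite -mulr_sumr (reindex_inj (subrI y)) /=.
by under eq_bigr => x _ do rewrite subKr.
Qed.

(** By Plancherel both sides come from the sum of the squared norms of the coefficients of [h] times
    those of [k]. *)
Lemma sum_conv_sqr h k :
  \sum_x conv h k x ^+ 2 = \sum_x corr h x * corr k x.
Proof.
apply: (fmorph_inj (@ratr algC)); have N0 : #|G|%:R != 0 :> algC.
  by rewrite -(ratr_nat algC) fmorph_eq0 gt_eqF ?card_gt0.
apply: (mulfI N0); rewrite -sum_fourier_sqr -plancherel.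
apply: eq_bigr => xi _; rewrite !fourier_corr fourier_conv normrM exprMn.
by rewrite conj_Creal // rpredX // normr_real.
Qed.

(** Translating the set of [bohr_large] by one of its elements turns the bound on differences into a
    bound on points. *)
Lemma bohr_translate k (S : {set G}) : (0 < k)%N -> exists2 B : {set G},
    forall t xi, t \in B -> xi \in S -> `|e (t * xi) - 1| <= 2%:R / k%:R
    & (#|G| <= bohr_bound k #|S| * #|B|)%N.
Proof.
move=> k0; have [B HB le_B] := bohr_large (enum S) k0.
have B0 : (0 < #|B|)%N.
  have : (0 < #|G|)%N by apply/card_gt0P; exists 0.
  by move/leq_trans/(_ le_B); rewrite muln_gt0 => /andP[].
have [t0 t0B] := card_gt0P B0.
exists [set t | t + t0 \in B] => [t xi|].
  rewrite inE => tB xiS; rewrite -[t](addrK t0).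
  by apply: HB; rewrite ?mem_enum.
rewrite -cardE in le_B; apply: leq_trans le_B _; rewrite leq_mul2l; apply/orP; right.
rewrite -(card_imset B (addIr (- t0))); apply: subset_leq_card.
by apply/subsetP=> _ /imsetP[t tB ->]; rewrite inE subrK.
Qed.

Lemma fourier_uniform_close (B : {set G}) xi r : (0 < #|B|)%N ->
  (forall t, t \in B -> `|e (t * xi) - 1| <= r) ->
  `|1 - fourier (uniform B) xi| <= r.
Proof.
move=> B0 HB.
have sumB (c : algC) : \sum_x ratr (uniform B x) * c = c.
  by rewrite -mulr_suml -rmorph_sum sum_uniform //= rmorph1 mul1r.
rewrite distrC -[X in _ - X](sumB 1) -sumrB -[leRHS]sumB.
apply: le_trans (ler_norm_sum _ _ _) _; apply: ler_sum => x _.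
rewrite -mulrBr normrM ger0_norm ?ler0q ?uniform_ge0 //.
have [xB|xB] := boolP (x \in B).
  by rewrite ler_wpM2l ?ler0q ?uniform_ge0 // HB.
by rewrite /uniform (negbTE xB) mul0r rmorph0 !mul0r.
Qed.

Section SolutionFree.
Context (a b : G) (A : {set G}).
Context (a_inj : injective ( *%R a)) (b_inj : injective ( *%R b)).
Context (ab_inj : injective ( *%R (a + b))).
Context (A_gt0 : (0 < #|A|)%N).
(** The third alternative is allowed for all [a] and [b]. It adds only one more family of at most
    [#|A|^2] solutions to the count. *)
Context (A_free : forall x1 x2 x3 x4 x5,
  x1 \in A -> x2 \in A -> x3 \in A -> x4 \in A -> x5 \in A ->
  a * x1 + a * x2 + b * x3 = a * x4 + (a + b) * x5 ->
  [\/ [/\ x1 = x4, x2 = x5 & x3 = x5], [/\ x1 = x5, x2 = x4 & x3 = x5]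
    | [/\ x1 = x5, x2 = x5 & x3 = x4]]).

Let m : rat := #|A|%:R.
Let N : rat := #|G|%:R.
Let m0 : 0 < m. Proof. by rewrite ltr0n. Qed.
Local Notation g := (uniform A).

Let m2_ge0 : 0 <= m ^- 2. Proof. by rewrite invr_ge0 exprn_ge0 // ltW. Qed.

Lemma sidon x1 x2 x4 x5 : x1 \in A -> x2 \in A -> x4 \in A -> x5 \in A ->
  x1 + x2 = x4 + x5 -> (x1 = x4 /\ x2 = x5) \/ (x1 = x5 /\ x2 = x4).
Proof.
move=> A1 A2 A4 A5 E; case: (A_free A1 A2 A5 A4 A5).
- by rewrite -mulrDr E; ring.
- by case; left.
- by case; right.
- by case=> -> -> ->; left.
Qed.

Lemma corr_uniform_le d : d != 0 -> corr g d <= m ^- 2.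
Proof.
move=> d0.
have [y /andP[yA ydA]|none] := pickP (fun y => (y \in A) && (y - d \in A)).
  rewrite /corr (bigD1 y) //= big1 ?addr0 => [|z z_neq].
    by rewrite /uniform yA ydA !mul1r -invfM expr2.
  rewrite /uniform; have [zA|] := boolP (z \in A); last by rewrite !mul0r.
  have [zdA|] := boolP (z - d \in A); last by rewrite mul0r mulr0.
  have E : z + (y - d) = y + (z - d) by ring.
  have [[zy _]|[zzd _]] := sidon zA ydA yA zdA E; first by rewrite zy eqxx in z_neq.
  have /eqP := subrr z; rewrite {2}zzd opprB addrC subrK => /eqP dE.
  by rewrite dE eqxx in d0.
rewrite /corr big1 // => y _; rewrite /uniform.
by have := none y; case: (y \in A); case: (y - d \in A);
  rewrite ?mul0r ?mulr0.
Qed.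

(** The Sidon property caps the terms with [d != 0] by [m ^- 2], and [F] has mass 1. With
    [F = corr g] this gives the fourth moment; with [F] the correlation of a Bohr set it gives the
    [L2] bound after smoothing. *)
Lemma sum_corr_uniform_le (F : G -> rat) :
  (forall d, 0 <= F d) -> \sum_d F d = 1 ->
  \sum_d corr g d * F d <= F 0 / m + m ^- 2.
Proof.
move=> F0 F1; rewrite (bigD1 0) //= corr_uniform0 // mulrC lerD2l.
apply: le_trans (_ : _ <= \sum_(d | d != 0) m ^- 2 * F d) _.
  by apply: ler_sum => d d0; rewrite ler_wpM2r // corr_uniform_le.
rewrite -mulr_sumr ler_piMr //.
by rewrite -F1 [leRHS](bigD1 0) //= lerDr.
Qed.

(** The Sidon size bound, read off from the total mass 1 of [corr g]. It later forces the Bohr set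
    to be at least as large as [A]. *)
Lemma card_sqr_le : m ^+ 2 <= m + N.
Proof.
have := sum_corr g; rewrite sum_uniform // expr1n (bigD1 0) //= corr_uniform0 // => E.
have : \sum_(d : G | d != 0) corr g d <= \sum_(d : G) m ^- 2.
  rewrite [leRHS](bigD1 0) //= -[leLHS]add0r lerD //.
  by apply: ler_sum => d; apply: corr_uniform_le.
rewrite sumr_const -[leRHS]mulr_natl -/N => bound.
have {}bound : 1 <= m^-1 + N * m ^- 2 by rewrite -{1}E lerD2l.
have m2 : 0 < m ^+ 2 by rewrite exprn_gt0.
rewrite -(ler_pM2l m2) mulr1 mulrDr mulrCA divff ?gt_eqF // mulr1 in bound.
by rewrite expr2 mulfK ?gt_eqF in bound.
Qed.

Lemma sol_weight_uniform_le : sol_weight a b g <= 3%:R / m ^+ 3.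
Proof.
pose i x : rat := (x \in A)%:R.
have i0 x : 0 <= i x by [].
pose W x t s y := i x * i (x + a * t) * (i y * i (y - s) * i (x - b * t - s)).
have ->: sol_weight a b g = m ^- 5 * \sum_x \sum_t \sum_s \sum_y W x t s y.
  rewrite mulr_sumr; apply: eq_bigr => x _; rewrite mulr_sumr; apply: eq_bigr => t _.
  rewrite [in LHS]mulr_sumr mulr_sumr; apply: eq_bigr => s _.
  rewrite mulr_suml !mulr_sumr; apply: eq_bigr => y _.
  by rewrite /uniform -/m -!/(i _) /W; field; rewrite gt_eqF.
(* One summand for each alternative of [A_free], in the coordinates
   [(y, x - b t - s, x + a t, y - s, x)]. Each has two free elements of [A], hence total mass
   [m ^ 2]. *)
pose V x t s y := i x * i y * (t == 0)%:R * (s == 0)%:R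
  + i x * i (x - s) * (t == 0)%:R * (y == x)%:R
  + i x * i (x + a * t) * (s == - (a * t))%:R * (y == x)%:R.
have WV x t s y : W x t s y <= V x t s y.
  have V0 : 0 <= V x t s y by rewrite !addr_ge0 // !mulr_ge0.
  have [/and5P[xA zA yA wA vA]|] := boolP [&& x \in A, x + a * t \in A, y \in A,
      y - s \in A & x - b * t - s \in A]; last first.
    rewrite /W /i; do 5![case: (_ \in A); rewrite /= ?mul0r ?mulr0 //].
  have t0 : x + a * t = x -> t = 0.
    by move=> E; apply: a_inj; apply: (addrI x); rewrite mulr0 addr0.
  rewrite /W /V /i xA yA zA wA vA !mul1r.
  have: a * y + a * (x - b * t - s) + b * (x + a * t) = a * (y - s) + (a + b) * x by ring.
  case/(A_free yA vA zA wA xA) => [[yE _ xE]|[yE _ xE]|[yE _ zE]].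
  - have -> : s = 0 by rewrite -[s](subKr y) -yE subrr.
    by rewrite (t0 xE) !eqxx mul1r -addrA lerDl addr_ge0 ?mulr_ge0.
  - by rewrite (t0 xE) -yE wA !eqxx !mul1r addrAC lerDr addr_ge0 ?mulr_ge0.
  - have -> : s = - (a * t) by rewrite -[s](subKr y) -zE yE; ring.
    by rewrite yE !eqxx mul1r lerDr addr_ge0 ?mulr_ge0.
have sumV : \sum_x \sum_t \sum_s \sum_y V x t s y = 3%:R * m ^+ 2.
  have sum_i : \sum_x i x = m by exact: sum_ind.
  transitivity (\sum_x i x * (3%:R * m)); last by rewrite -mulr_suml sum_i; ring.
  apply: eq_bigr => x _.
  transitivity (\sum_t (i x * m * (t == 0)%:R + i x * m * (t == 0)%:R
                        + i x * i (x + a * t))); last first.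
    rewrite !big_split /= !sum_pick -mulr_sumr.
    have <- : m = \sum_t i (x + a * t).
      by rewrite -sum_i (reindex_inj (addrI x)) (reindex_inj a_inj).
    ring.
  apply: eq_bigr => t _.
  transitivity (\sum_s (i x * m * (t == 0)%:R * (s == 0)%:R
     + i x * i (x - s) * (t == 0)%:R + i x * i (x + a * t) * (s == - (a * t))%:R)).
    apply: eq_bigr => s _; rewrite !big_split /=.
    by rewrite !sum_pick -!mulr_suml -mulr_sumr sum_i.
  rewrite !big_split /= !sum_pick -mulr_suml -mulr_sumr.
  by rewrite -sum_i [in X in _ = _ + X + _](reindex_inj (subrI x)).
have WV_sum : \sum_x \sum_t \sum_s \sum_y W x t s y <= 3%:R * m ^+ 2.
  rewrite -sumV; apply: ler_sum => x _; apply: ler_sum => t _.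
  by apply: ler_sum => s _; apply: ler_sum => y _.
apply: le_trans (_ : _ <= m ^- 5 * (3%:R * m ^+ 2)) _.
  by rewrite ler_wpM2l // invr_ge0 exprn_ge0 // ltW.
by rewrite le_eqVlt; apply/orP; left; apply/eqP; field; rewrite gt_eqF.
Qed.

Lemma sum_fourier4_uniform_le :
  \sum_xi `|fourier g xi| ^+ 4 <= ratr (2%:R * N / m ^+ 2).
Proof.
have ->: \sum_xi `|fourier g xi| ^+ 4 = #|G|%:R * ratr (\sum_x corr g x ^+ 2).
  rewrite -sum_fourier_sqr; apply: eq_bigr => xi _.
  by rewrite fourier_corr normrX normr_id -exprM.
rewrite -(ratr_nat algC) -rmorphM ler_rat /= -/N.
rewrite (_ : 2%:R * N / _ = N * (2%:R / m ^+ 2)); last by ring.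
apply: ler_wpM2l => //; under eq_bigr => x _ do rewrite expr2.
apply: le_trans (sum_corr_uniform_le (corr_ge0 (uniform_ge0 A)) _) _.
  by rewrite sum_corr sum_uniform // expr1n.
by rewrite corr_uniform0 // -/m le_eqVlt; apply/orP; left; apply/eqP; field; rewrite gt_eqF.
Qed.

(** The diagonal term is [1 / (m #|B|)], so [#|A| <= #|B|] makes the bound independent of [B]. *)
Lemma sum_conv_sqr_le (B : {set G}) : (#|A| <= #|B|)%N ->
  \sum_x conv g (uniform B) x ^+ 2 <= 2%:R / m ^+ 2.
Proof.
move=> le_AB; have B0 : (0 < #|B|)%N := leq_trans A_gt0 le_AB.
rewrite sum_conv_sqr; apply: le_trans (sum_corr_uniform_le _ _) _.
- exact: corr_ge0 (uniform_ge0 B).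
- by rewrite sum_corr sum_uniform // expr1n.
rewrite corr_uniform0 // (_ : 2%:R / _ = m^-1 / m + m ^- 2); last first.
  by field; rewrite gt_eqF.
rewrite lerD2r ler_pM2r ?invr_gt0 // lef_pV2 ?posrE ?ltr0n //.
by rewrite ler_nat.
Qed.

(** With [L = 2 kappa], [M = dense_bound L] and [d] this scale, the transfer error [30 L / d] equals
    [1 / (8 L M)], a quarter of the dense lower bound [1 / (2 L M)]. *)
Definition transfer_scale (kappa : nat) : nat :=
  240 * (2 * kappa) ^ 2 * dense_bound (2 * kappa).

(** The first summand ensures [#|A| <= #|B|]. The second brings the trivial count [3 kappa / m] down
    to [1 / (8 L M)]. *)
Definition size_bound (kappa : nat) : nat :=
  2 * bohr_bound (transfer_scale kappa) (2 * kappa * transfer_scale kappa ^ 4)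
  + 24 * kappa * (2 * kappa) * dense_bound (2 * kappa).

Lemma solution_free_bound (kappa : nat) :
  (#|G| <= kappa * #|A| ^ 2)%N -> (#|A| < size_bound kappa)%N.
Proof.
move=> le_G; rewrite ltnNge; apply/negP => large.
have N0 : 0 < N := card_gt0.
have kappa0 : (0 < kappa)%N.
  have : (0 < #|G|)%N by rewrite -(ltr_nat rat).
  by move/leq_trans/(_ le_G); rewrite muln_gt0 => /andP[].
have [L LE] : {L | L = (2 * kappa)%N} by exists (2 * kappa)%N.
have [M ME] : {M | M = dense_bound L} by exists (dense_bound L).
have [d dE] : {d | d = (240 * L ^ 2 * M)%N} by exists (240 * L ^ 2 * M)%N.
have [Q QE] : {Q | Q = bohr_bound d (L * d ^ 4)} by exists (bohr_bound d (L * d ^ 4)).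
rewrite /size_bound /transfer_scale -LE -ME -dE -QE in large.
have L0 : (0 < L)%N by rewrite LE muln_gt0.
have M0 : (0 < M)%N by rewrite ME bohr_bound_gt0.
have d0 : (0 < d)%N by rewrite dE muln_gt0 M0 andbT muln_gt0 expn_gt0 L0.
have Q0 : (0 < Q)%N by rewrite QE bohr_bound_gt0.
have {}dE : d%:R = 240%:R * L%:R ^+ 2 * M%:R :> rat.
  by rewrite dE natrM [X in X * _]natrM natrX.
have leN : N <= kappa%:R * m ^+ 2 by rewrite /m -natrX -natrM ler_nat.
have LE' : L%:R = 2%:R * kappa%:R :> rat by rewrite LE natrM.
have leL : 2%:R * N / m ^+ 2 <= L%:R.
  rewrite ler_pdivrMr; last by rewrite exprn_gt0.
  by rewrite LE' -[leRHS]mulrA ler_pM2l.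
have g4 : \sum_xi `|fourier g xi| ^+ 4 <= L%:R.
  apply: le_trans sum_fourier4_uniform_le _.
  by rewrite -(ratr_nat _ L) ler_rat.
have [D DE] : {D | D = (d ^ 4)%N} by exists (d ^ 4)%N.
rewrite -DE in QE; have D0 : (0 < D)%N by rewrite DE expn_gt0 d0.
pose Lam := [set xi | D%:R^-1 <= `|fourier g xi| ^+ 4].
have cardLam : (#|Lam| <= L * D)%N.
  by apply: card_large_le D0 _ g4 => xi; rewrite exprn_ge0.
have [B HB le_B] := bohr_translate Lam d0.
have {}le_B : (#|G| <= Q * #|B|)%N.
  by apply: leq_trans le_B _; rewrite leq_mul2r QE leq_bohr_bound ?orbT.
have large1 : (2 * Q <= #|A|)%N by apply: leq_trans large; rewrite leq_addr.
have large2 : (24 * kappa * L * M <= #|A|)%N by apply: leq_trans large; rewrite leq_addl.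
(* If [#|B| < #|A|], then [m ^ 2 <= m + Q #|B| < (1 + Q) m <= 2 Q m <= m ^ 2]. *)
have le_AB : (#|A| <= #|B|)%N.
  have sq : (#|A| ^ 2 <= #|A| + Q * #|B|)%N.
    rewrite -(ler_nat rat) natrX natrD; apply: le_trans card_sqr_le _.
    by rewrite lerD2l ler_nat.
  apply: contraT; rewrite -ltnNge => BA; rewrite -(ltnn (#|A| ^ 2)).
  apply: leq_ltn_trans sq _.
  apply: leq_trans (_ : (#|A| + Q * #|A| <= _)%N); first by rewrite ltn_add2l ltn_pmul2l.
  rewrite -mulSn -mulnn leq_mul2r; apply/orP; right; apply: leq_trans large1.
  by rewrite mul2n -addnn -add1n leq_add2r.
have B0 : (0 < #|B|)%N := leq_trans A_gt0 le_AB.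
have transfer := sol_weight_transfer a_inj b_inj ab_inj (uniform_ge0 A)
  (sum_uniform A_gt0) (uniform_ge0 B) (sum_uniform B0) g4 d0.
have {}transfer : `|N * sol_weight a b g - N * sol_weight a b (conv g (uniform B))|
    <= 30%:R * L%:R / d%:R.
  apply: transfer => xi big; apply: (fourier_uniform_close B0) => t tB.
  apply: HB tB _; rewrite inE DE natrX -exprVn.
  by apply: lerXn2r; rewrite ?nnegrE ?invr_ge0.
have dense : 1 <= 2%:R * L%:R * M%:R * (N * sol_weight a b (conv g (uniform B))).
  rewrite ME; apply: (sol_weight_dense _ _ _ b a_inj).
  - exact: conv_ge0 (uniform_ge0 A) (uniform_ge0 B).
  - by rewrite sum_conv (sum_uniform A_gt0) (sum_uniform B0) mulr1.
  - apply: le_trans leL; rewrite [leRHS]mulrAC [leRHS]mulrC.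
    by rewrite (ler_pM2l card_gt0); apply: sum_conv_sqr_le.
have sparse : N * sol_weight a b g <= 3%:R * kappa%:R / m.
  apply: le_trans (_ : _ <= N * (3%:R / m ^+ 3)) _.
    by rewrite (ler_pM2l card_gt0); apply: sol_weight_uniform_le.
  rewrite (_ : 3%:R * _ / _ = kappa%:R * m ^+ 2 * (3%:R / m ^+ 3)); last first.
    by field; rewrite gt_eqF.
  by apply: ler_wpM2r leN; rewrite divr_ge0 ?exprn_ge0 ?(ltW m0).
have L0' : 0 < L%:R :> rat by rewrite ltr0n.
have M0' : 0 < M%:R :> rat by rewrite ltr0n.
have P : 0 < 8%:R * L%:R * M%:R :> rat
  by exact: mulr_gt0 (mulr_gt0 (ltr0Sn _ 7) L0') M0'.
have P2 : 0 < 2%:R * L%:R * M%:R :> rat.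
  exact: mulr_gt0 (mulr_gt0 (ltr0Sn _ 1) L0') M0'.
have small_m : 3%:R * kappa%:R / m <= (8%:R * L%:R * M%:R)^-1.
  rewrite (ler_pdivrMr _ _ m0) (ler_pdivlMl _ _ P).
  move: large2; rewrite -(ler_nat rat) natrM [X in X * _]natrM [X in X * _ * _]natrM.
  by apply: le_trans; rewrite le_eqVlt; apply/orP; left; apply/eqP; ring.
have small_d : 30%:R * L%:R / d%:R = (8%:R * L%:R * M%:R)^-1 :> rat.
  by rewrite dE; field; rewrite !gt_eqF.
have quarter : (2%:R * L%:R * M%:R)^-1 = 4%:R * (8%:R * L%:R * M%:R)^-1 :> rat.
  by field; rewrite !gt_eqF.
have pos : 0 < (8%:R * L%:R * M%:R)^-1 :> rat by rewrite invr_gt0.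
(* In units of [1 / (8 L M)]: [y] is at least 4, [x] is at most 1, and they differ by at most 1. *)
move: transfer dense sparse; rewrite small_d.
move: (N * sol_weight a b g) (N * sol_weight a b (conv _ _)) => x y.
rewrite ler_norml => /andP[transfer _] dense sparse.
have {}dense : (2%:R * L%:R * M%:R)^-1 <= y.
  by rewrite -[leLHS]mulr1 (ler_pdivrMl _ _ P2).
lra.
Qed.

End SolutionFree.
End Fourier.

(** * Cyclic groups and integers *)

Section Cyclic.
Context (p : nat) (omega : algC).
Context (omega_prim : p.+2.-primitive_root omega).

(** Orthogonality is a geometric sum with ratio [omega ^+ x], which differs from 1 when [x] is
    nonzero because [omega] is primitive. *)
Lemma cyclic_character : nondegenerate_character (fun x : 'I_p.+2 => omega ^+ x).
Proof.
have omega_norm : `|omega| = 1.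
  apply/eqP; rewrite -(@pexpr_eq1 _ _ p.+2) // -normrX prim_expr_order //.
  by rewrite normr1.
split=> [x y|x|x] /=.
- by rewrite prim_expr_mod // exprD.
- by rewrite normrX omega_norm expr1n.
have powE (y : 'I_p.+2) : omega ^+ (x * y)%R = (omega ^+ x) ^+ y.
  by rewrite /= prim_expr_mod // exprM.
under eq_bigr => y _ do rewrite powE.
rewrite card_ord; have [->|x0] := eqVneq x 0.
  under eq_bigr => y _ do rewrite expr0 expr1n.
  by rewrite sumr_const card_ord mul1r.
have z1 : (omega ^+ x) ^+ p.+2 = 1.
  by rewrite -exprM mulnC exprM (prim_expr_order omega_prim) expr1n.
have z_neq1 : omega ^+ x - 1 != 0.
  rewrite subr_eq0 -[X in _ != X](expr0 omega) (eq_prim_root_expr omega_prim).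
  rewrite !modn_small //; apply: contraNN x0 => /eqP E; apply/eqP; exact: val_inj.
rewrite mul0r; apply: (mulfI z_neq1).
by rewrite mulr0 -(subrX1 (omega ^+ x)) z1 subrr.
Qed.

End Cyclic.

(** The modulus is one more than a multiple of [a], [b] and [a + b], hence coprime to each of them.
    It also exceeds [(2 a + b) n], which bounds both sides of the equation, so a solution modulo it
    is a solution in integers. *)
Lemma nat_solution_free_bound (a b n kappa : nat) (A : seq nat) :
  (0 < a)%N -> (0 < b)%N -> (0 < n)%N -> uniq A -> (forall x, x \in A -> (x <= n)%N) ->
  (forall x1 x2 x3 x4 x5,
    x1 \in A -> x2 \in A -> x3 \in A -> x4 \in A -> x5 \in A ->
    (a * x1 + a * x2 + b * x3 = a * x4 + (a + b) * x5)%N ->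
    [\/ [/\ x1 = x4, x2 = x5 & x3 = x5], [/\ x1 = x5, x2 = x4 & x3 = x5]
      | [/\ x1 = x5, x2 = x5 & x3 = x4]]) ->
  ((n * ((a + a + b) * (a * b * (a + b)))).+1 <= kappa * size A ^ 2)%N ->
  (size A <= size_bound kappa)%N.
Proof.
move=> a0 b0 n0 uA An A_free le_N.
have [->|A0] := posnP (size A); first by [].
set K := (n * _)%N in le_N.
have [p pE] : {p | p.+1 = K}.
  by exists K.-1; rewrite prednK // !muln_gt0 n0 !addn_gt0 a0 b0.
have [omega omega_prim] := C_prim_root_exists (ltn0Sn p.+1).
pose f (x : nat) : 'I_p.+2 := x%:R.
have fE x : f x = (x %% p.+2)%N :> nat by exact: (@val_Zp_nat p.+2).
have lin_lt x : (x <= (a + a + b) * n)%N -> (x < p.+2)%N.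
  move=> le_x; rewrite ltnS pE; apply: leq_trans le_x _.
  by rewrite mulnC leq_mul2l leq_pmulr ?orbT // !muln_gt0 addn_gt0 a0 b0.
have f_inj : {in A &, injective f}.
  have small x : x \in A -> (x < p.+2)%N.
    move=> /An le_x; apply: lin_lt; apply: leq_trans le_x _.
    by rewrite leq_pmull // !addn_gt0 a0.
  by move=> x y xA yA /(congr1 val) /=; rewrite !fE !modn_small ?small.
have inj_nat c : (c %| K)%N -> injective ( *%R (c%:R : 'I_p.+2)).
  move=> cK; apply: mulrI; rewrite (@unitZpE p.+2) // -pE in cK *.
  exact: coprime_dvdr cK (coprimeSn _).
pose AG := [set y in [seq f x | x <- A]].
have cardAG : #|AG| = size A.
  have uniqf : uniq [seq f x | x <- A] by rewrite (map_inj_in_uniq f_inj).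
  by rewrite cardsE (card_uniqP uniqf) size_map.
have dvdKa : (a %| K)%N by do 2!apply: dvdn_mull; do 2!apply: dvdn_mulr.
have dvdKb : (b %| K)%N by do 2!apply: dvdn_mull; apply: dvdn_mulr; apply: dvdn_mull.
have dvdKab : (a + b %| K)%N by do 3!apply: dvdn_mull.
rewrite ltnW // -cardAG.
apply: (solution_free_bound (cyclic_character omega_prim) (a := a%:R) (b := b%:R)).
- exact: inj_nat.
- exact: inj_nat.
- by rewrite -natrD; exact: inj_nat.
- by rewrite cardAG.
- move=> y1 y2 y3 y4 y5; rewrite !inE.
  move=> /mapP[x1 A1 ->] /mapP[x2 A2 ->] /mapP[x3 A3 ->] /mapP[x4 A4 ->] /mapP[x5 A5 ->].
  rewrite /f -[a%:R + b%:R]natrD -!natrM -!natrD => /(congr1 (@nat_of_ord _)).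
  rewrite -!/(f _) !fE !modn_small.
  + move=> E; case: (A_free x1 x2 x3 x4 x5 A1 A2 A3 A4 A5 E) => [] [-> -> ->];
      by [constructor 1|constructor 2|constructor 3].
  + apply: lin_lt; rewrite !mulnDl addnA.
    by apply: leq_add; first apply: leq_add; rewrite leq_mul2l An ?orbT.
  + apply: lin_lt; rewrite !mulnDl.
    by apply: leq_add; first apply: leq_add; rewrite leq_mul2l An ?orbT.
- by rewrite card_ord pE cardAG.
Qed.

(** * Passage from sequences to duplicate-free lists *)

Lemma InP (x : nat) (s : seq nat) : reflect (List.In x s) (x \in s).
Proof.
elim: s => [|y s IHs] /=; first by rewrite in_nil; constructor.
rewrite inE; apply: (iffP orP) => [[/eqP->|/IHs]|[->|/IHs]];
  by [left|right|left; rewrite eqxx].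
Qed.

Lemma NoDup_uniq (s : seq nat) : List.NoDup s -> uniq s.
Proof.
by elim=> //= x l x_l _ ->; rewrite andbT; apply/InP.
Qed.

Lemma list_solution_free_bound (a b n kappa : nat) (A : list nat) :
  (0 < a)%coq_nat -> (0 < b)%coq_nat -> (0 < n)%coq_nat ->
  List.NoDup A -> (forall x, List.In x A -> (x <= n)%coq_nat) ->
  (forall x1 x2 x3 x4 x5, List.In x1 A -> List.In x2 A -> List.In x3 A ->
    List.In x4 A -> List.In x5 A ->
    (a * x1 + a * x2 + b * x3 = a * x4 + (a + b) * x5)%coq_nat ->
    x1 = x4 /\ x2 = x5 /\ x3 = x5 \/ x1 = x5 /\ x2 = x4 /\ x3 = x5 \/
    x1 = x5 /\ x2 = x5 /\ x3 = x4) ->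
  (S (n * ((a + a + b) * (a * b * (a + b)))) <= kappa * (length A * length A))%coq_nat ->
  (length A <= size_bound kappa)%coq_nat.
Proof.
move=> /ssrnat.ltP a0 /ssrnat.ltP b0 /ssrnat.ltP n0 /NoDup_uniq uA An A_free le_N.
have -> : length A = size A by [].
apply/ssrnat.leP; apply: (nat_solution_free_bound a0 b0 n0 uA).
- by move=> x /InP/An/ssrnat.leP.
- move=> x1 x2 x3 x4 x5 /InP A1 /InP A2 /InP A3 /InP A4 /InP A5 E.
  case: (A_free x1 x2 x3 x4 x5 A1 A2 A3 A4 A5 E) => [|[]] [-> [-> ->]];
    by [constructor 1|constructor 2|constructor 3].
- exact/ssrnat.leP.
Qed.

End SparseFourier.

(** * Choice of the threshold and the final contradiction *)

Theorem theorem1p16 (a b : Z) (ha : (0 < a)%Z) (hb : (0 < b)%Z) :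
  forall eps : R, (0 < eps)%R ->
  exists n0 : nat, forall n : nat, (n0 <= n)%nat ->
  forall A : list Z,
    NoDup A ->
    (forall x, In x A -> (1 <= x <= Z.of_nat n)%Z) ->
    no_nontrivial_solution a b A ->
    (INR (length A) <= eps * sqrt (INR n))%R.
Proof.
intros eps eps0.
set (c := Z.to_nat a); set (d := Z.to_nat b).
assert (aE : a = Z.of_nat c) by (unfold c; lia).
assert (bE : b = Z.of_nat d) by (unfold d; lia).
set (K := ((c + c + d) * (c * d * (c + d)))%nat).
(* If [|A| > eps sqrt n], the modulus satisfies [n K + 1 <= n (K + 1) <= kappa eps^2 n <= kappa
   |A|^2]. *)
destruct (INR_unbounded ((INR K + 1) / (eps * eps))) as [kappa Hkappa].
set (M := SparseFourier.size_bound kappa).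
(* Beyond [n1], [M <= eps sqrt n], so a set larger than [eps sqrt n] exceeds the bound [M]. The
   successor in the threshold keeps [n] positive. *)
destruct (INR_unbounded ((INR M / eps) * (INR M / eps))) as [n1 Hn1].
exists (S n1); intros n Hn A ndA rangeA freeA.
destruct (Rle_or_lt (INR (length A)) (eps * sqrt (INR n))) as [|big]; [assumption|exfalso].
set (m := length A) in *.
assert (n_ge : (INR n1 <= INR n)%R) by (apply le_INR; lia).
assert (sq0 : (0 <= sqrt (INR n))%R) by apply sqrt_pos.
assert (sqE : (sqrt (INR n) * sqrt (INR n) = INR n)%R) by (apply sqrt_sqrt, pos_INR).
assert (M0 : (0 <= INR M)%R) by apply pos_INR.
assert (m0 : (0 <= INR m)%R) by apply pos_INR.
assert (M_lt : (INR M < INR m)%R).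
{ apply Rle_lt_trans with (2 := big).
  assert (q0 : (0 <= INR M / eps)%R)
    by (apply Rmult_le_pos; [|apply Rlt_le, Rinv_0_lt_compat]; assumption).
  assert (q_le : (INR M / eps <= sqrt (INR n))%R).
  { apply Rsqr_incr_0; unfold Rsqr; lra. }
  replace (INR M) with (eps * (INR M / eps))%R by (field; lra).
  apply Rmult_le_compat_l; lra. }
assert (m_le : (m <= M)%nat).
{ assert (mE : m = length (map Z.to_nat A)) by (symmetry; apply length_map).
  rewrite mE; apply (SparseFourier.list_solution_free_bound (a := c) (b := d) (n := n)).
  - lia.
  - lia.
  - lia.
  - apply NoDup_map_NoDup_ForallPairs; [|assumption].
    intros x y Hx Hy E; apply rangeA in Hx; apply rangeA in Hy; lia.
  - intros x Hx; apply in_map_iff in Hx; destruct Hx as [z [<- Hz]].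
    apply rangeA in Hz; lia.
  - intros x1 x2 x3 x4 x5 H1 H2 H3 H4 H5 E.
    assert (memA : forall x, In x (map Z.to_nat A) -> In (Z.of_nat x) A).
    { intros x Hx; apply in_map_iff in Hx; destruct Hx as [z [<- Hz]].
      rewrite Z2Nat.id; [assumption|]; apply rangeA in Hz; lia. }
    apply memA in H1, H2, H3, H4, H5.
    assert (sol : is_solution a b (Z.of_nat x1) (Z.of_nat x2) (Z.of_nat x3)
                    (Z.of_nat x4) (Z.of_nat x5)).
    { unfold is_solution; rewrite aE, bE, <- !Nat2Z.inj_add, <- !Nat2Z.inj_mul,
        <- !Nat2Z.inj_add; f_equal; exact E. }
    destruct (freeA _ _ _ _ _ H1 H2 H3 H4 H5 sol) as [x [y Hxy]]; lia.
  - rewrite <- mE; change (S (n * K) <= kappa * (m * m))%nat; clearbody K; apply INR_le.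
    rewrite S_INR, !mult_INR.
    assert (n1' : (1 <= INR n)%R) by (apply (le_INR 1); lia).
    assert (K0 : (0 <= INR K)%R) by apply pos_INR.
    assert (k_le : (INR K + 1 <= INR kappa * (eps * eps))%R).
    { apply Rlt_le; apply (Rmult_lt_compat_r (eps * eps)) in Hkappa;
        [|apply Rmult_lt_0_compat; assumption].
      replace ((INR K + 1) / (eps * eps) * (eps * eps))%R with (INR K + 1)%R in Hkappa;
        [lra|field; lra]. }
    assert (m_sq : (eps * eps * INR n <= INR m * INR m)%R).
    { replace (eps * eps * INR n)%R with ((eps * sqrt (INR n)) * (eps * sqrt (INR n)))%R;
        [|transitivity (eps * eps * (sqrt (INR n) * sqrt (INR n)))%R;
          [ring|rewrite sqE; reflexivity]].
      assert (0 <= eps * sqrt (INR n))%R by (apply Rmult_le_pos; lra).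
      apply Rmult_le_compat; lra. }
    apply Rle_trans with (INR n * (INR K + 1))%R; [lra|].
    apply Rle_trans with (INR n * (INR kappa * (eps * eps)))%R.
    { apply Rmult_le_compat_l; lra. }
    replace (INR n * (INR kappa * (eps * eps)))%R
      with (INR kappa * (eps * eps * INR n))%R by ring.
    apply Rmult_le_compat_l; [apply pos_INR|assumption]. }
apply le_INR in m_le; lra.
Qed.
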